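(* As the data sample size $N=\min\{N_2,\dots,N_T\}$ goes to $\infty$, $\hat z(0)\to z(0)$. Furthermore, $\hat U(0)$ converges to $U(0)$, i.e. $$\lim_{N\to\infty}\ \sup_{x\in\hat U(0)}\|x-U(0)\|=0,$$ where $\|x-U(0)\|$ denotes the distance from $x$ to the set $U(0)$. Here $z(0)$ and $U(0)$ are the optimal value and the set of optimal solutions of the multistage stochastic program under the true distributions, and $\hat z(0)$ and $\hat U(0)$ are those of the multistage stochastic program under the reference distributions built from data of sizes $N_2,\dots,N_T$.
   Context: The horizon is $T\ge2$; first-stage data $c_1,b_1,A_1$ are deterministic. For $t=2,\dots,T$ the random parameter $\xi_t$ takes values in a finite set $\Omega_t=\{\xi_t^1,\dots,\xi_t^R\}$, with data $c_t(\xi_t),b_t(\xi_t),A_t(\xi_t),B_t(\xi_t)$, and the data process is stagewise independent. For given distributions $\mathbb P_2,\dots,\mathbb P_T$ on $\Omega_2,\dots,\Omega_T$, the (risk-neutral) multistage stochastic program (MSP) is $$\min_{A_1x_1\ge b_1}c_1x_1+\mathbb E_{\mathbb P_2}\Big[\min_{A_2x_2\ge b_2-B_2x_1}c_2x_2+\cdots+\mathbb E_{\mathbb P_T}\big[\min_{A_Tx_T\ge b_T-B_Tx_{T-1}}c_Tx_T\big]\Big].$$ A solution $x$ is the (finite-dimensional) collection of the decisions at all stages and all scenarios of the scenario tree (a stage-$t$ decision for each possible observation history up to stage $t$); it is feasible if the constraints hold along every scenario. Its objective value is the expected total cost, and an optimal solution is a feasible $x$ minimizing this expected total cost. The true distribution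 of $\xi_t$ on $\Omega_t$ is fixed but unknown. For each $t$, a reference distribution $f_0^t$ on $\Omega_t$ is constructed from the empirical distribution of $N_t$ historical data samples, and $f_0^t$ converges weakly to the true distribution of $\xi_t$ as $N_t\to\infty$. Standing assumption: the program has compact feasible set and relatively complete recourse, and the recourse function at each stage is bounded for each decision $x$. *)

(* Defs.v *)
From HB Require Import structures.
From mathcomp Require Import all_boot all_order all_algebra.
From mathcomp Require Import all_classical all_reals all_analysis.
Set Implicit Arguments.
Unset Strict Implicit.
Unset Printing Implicit Defensive.
Import Order.TTheory GRing.Theory Num.Theory.
Import numFieldNormedType.Exports.
Local Open Scope classical_set_scope.
Local Open Scope ring_scope.

(* Stages are numbered from 0: stage [t] below is stage [t+1] of the usual
   numbering 1, ..., T.  The support {xi^1, ..., xi^K} of the random parameter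
   observed at each stage after the first is encoded by its index set ['I_K]. *)

Record distr (R : realType) (K : nat) := Distr {
  mass :> 'I_K -> R ;
  mass_ge0 : forall r, 0 <= mass r ;
  mass_sum1 : \sum_r mass r = 1 }.

Definition expect (R : realType) (K : nat) (p : distr R K) (g : 'I_K -> R) : R :=
  \sum_r p r * g r.

(* The support is finite, hence discrete and compact: every real function on it
   is bounded and continuous, so that all of them are test functions. *)
Definition weak_cvg (R : realType) (K : nat) (p : nat -> distr R K)
    (q : distr R K) : Prop :=
  forall g : 'I_K -> R, (fun k => expect (p k) g) @ \oo --> expect q g.

(* The matrices indexed by [t] and [r] are the data of stage [t.+1] when its
   random parameter takes its [r]-th value. *)
Record msp (R : realType) (K : nat) := Msp {
  dim : nat -> nat ;
  nrows : nat -> nat ;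
  c1 : 'rV[R]_(dim 0) ;
  b1 : 'cV[R]_(nrows 0) ;
  A1 : 'M[R]_(nrows 0, dim 0) ;
  cost : forall t, 'I_K -> 'rV[R]_(dim t.+1) ;
  rhs : forall t, 'I_K -> 'cV[R]_(nrows t.+1) ;
  Amx : forall t, 'I_K -> 'M[R]_(nrows t.+1, dim t.+1) ;
  Bmx : forall t, 'I_K -> 'M[R]_(nrows t.+1, dim t) }.

Definition dotp (R : realType) (k : nat) (c : 'rV[R]_k) (x : 'cV[R]_k) : R :=
  (c *m x) 0 0.

Definition cv_le (R : realType) (k : nat) (u v : 'cV[R]_k) : Prop :=
  forall i, u i 0 <= v i 0.

Definition first_stage (R : realType) (K : nat) (M : msp R K) :
    set 'cV[R]_(dim M 0) :=
  [set x | cv_le (b1 M) (A1 M *m x)].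

Arguments first_stage {R K} M.

Definition next_stage (R : realType) (K : nat) (M : msp R K) (t : nat)
    (r : 'I_K) (y : 'cV[R]_(dim M t)) : set 'cV[R]_(dim M t.+1) :=
  [set x | cv_le (rhs M t r - Bmx M t r *m y) (Amx M t r *m x)].

(* [recourse P k y r]: optimal value of the problem starting at stage [t.+1],
   given the decision [y] of stage [t] and the observation [r], when [k] further
   stages follow.  [P t] is the distribution of the observation at stage [t.+1]. *)
Fixpoint recourse (R : realType) (K : nat) (M : msp R K) (P : nat -> distr R K)
    (k t : nat) (y : 'cV[R]_(dim M t)) (r : 'I_K) {struct k} : \bar R :=
  ereal_inf [set ((dotp (cost M t r) x)%:E +
      (if k is k'.+1
       then \sum_(r' : 'I_K) (P t.+1 r')%:E * recourse P k' x r'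
       else 0))%E | x in next_stage r y].

(* Meaningful for [2 <= T]. *)
Definition opt_value (R : realType) (K T : nat) (M : msp R K)
    (P : nat -> distr R K) : \bar R :=
  ereal_inf [set ((dotp (c1 M) x)%:E +
      \sum_(r : 'I_K) (P 0%N r)%:E * recourse P (T - 2) x r)%E
    | x in first_stage M].

(* Nodes of the scenario tree: observation histories, latest observation first.
   The node [h] belongs to stage [size h]. *)
Definition node (K T : nat) : Type := T.-1.-bseq 'I_K.

Definition solution (R : realType) (K T : nat) (M : msp R K) : Type :=
  prod_topology (fun h : node K T => 'cV[R]_(dim M (size h))).

Definition feasible (R : realType) (K T : nat) (M : msp R K) :
    set (solution T M) :=
  [set x : solution T M | first_stage M (x (@Bseq T.-1 'I_K [::] isT)) /\
     forall (h : seq 'I_K) (r : 'I_K) (hr : (size (r :: h) <= T.-1)%N),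
       next_stage r (x (Bseq (ltnW hr))) (x (@Bseq T.-1 'I_K (r :: h) hr))].

Arguments feasible {R K} T M.

Definition node_cost (R : realType) (K : nat) (M : msp R K) (h : seq 'I_K) :
    'rV[R]_(dim M (size h)) :=
  match h with [::] => c1 M | r :: h' => cost M (size h') r end.

(* The nodes along the scenario [s] are the suffixes of [s]. *)
Definition scenario_cost (R : realType) (K T : nat) (M : msp R K)
    (x : solution T M) (s : T.-1.-tuple 'I_K) : R :=
  \sum_(k < T) (let h : node K T :=
                  widen_bseq (leq_subr k T.-1)
                             [bseq of drop k (bseq_of_tuple s)] in
                dotp (node_cost M h) (x h)).

(* The product form is stagewise independence. *)
Fixpoint history_prob (R : realType) (K : nat) (P : nat -> distr R K)
    (h : seq 'I_K) : R :=
  if h is r :: h' then P (size h') r * history_prob P h' else 1.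

Definition expected_cost (R : realType) (K T : nat) (M : msp R K)
    (P : nat -> distr R K) (x : solution T M) : R :=
  \sum_(s : T.-1.-tuple 'I_K) history_prob P s * scenario_cost x s.

Definition opt_solutions (R : realType) (K T : nat) (M : msp R K)
    (P : nat -> distr R K) : set (solution T M) :=
  [set x : solution T M | feasible T M x /\
     forall y, feasible T M y -> expected_cost P x <= expected_cost P y].

Arguments opt_solutions {R K} T M P.

(* Decisions of stage [t] that end a history of feasible decisions. *)
Fixpoint reachable (R : realType) (K : nat) (M : msp R K) (t : nat) :
    set 'cV[R]_(dim M t) :=
  match t with
  | 0%N => first_stage M
  | t'.+1 => [set x | exists (y : 'cV[R]_(dim M t')) (r : 'I_K),
                reachable y /\ next_stage r y x]
  end.

Definition relatively_complete_recourse (R : realType) (K T : nat)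
    (M : msp R K) : Prop :=
  forall (t : nat) (y : 'cV[R]_(dim M t)) (r : 'I_K),
    (t.+1 < T)%N -> reachable y -> next_stage r y !=set0.

Definition bounded_recourse (R : realType) (K T : nat) (M : msp R K)
    (P : nat -> distr R K) : Prop :=
  forall (t : nat) (y : 'cV[R]_(dim M t)),
    (t.+1 < T)%N -> reachable y ->
    exists B : R, forall r, (`|recourse P (T - t.+2) y r| <= B%:E)%E.

Definition sol_dist (R : realType) (K T : nat) (M : msp R K)
    (x y : solution T M) : R :=
  Num.sqrt (\sum_(h : node K T) \sum_(j < dim M (size h))
              (x h j 0 - y h j 0) ^+ 2).

Definition dist_to_set (R : realType) (K T : nat) (M : msp R K)
    (x : solution T M) (U : set (solution T M)) : R :=
  inf [set sol_dist x y | y in U].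

(* For subsets of a compact feasible set the supremum is over a bounded set. *)
Definition deviation (R : realType) (K T : nat) (M : msp R K)
    (V U : set (solution T M)) : R :=
  sup [set dist_to_set x U | x in V].

(* [N t] is the number of samples of the random parameter of stage [t.+1]. *)
Definition min_size (T : nat) (N : nat -> nat) : nat :=
  \big[minn/N 0%N]_(t < T.-1) N t.

(* The limit [min_size T N -> oo] over families [N] of sample sizes. *)
Definition min_size_oo (T : nat) : set_system (nat -> nat) :=
  filter_from [set: nat] (fun k => [set N | (k <= min_size T N)%N]).

#[global] Instance min_size_oo_proper (T : nat) : ProperFilter (min_size_oo T).
Proof.
apply: filter_from_proper.
  apply: filter_from_filter; first by exists 0%N.
  move=> i j _ _; exists (maxn i j) => // N /=.
  by rewrite geq_max => /andP[].
move=> k _; exists (fun=> k) => /=; rewrite /min_size.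
by elim/big_ind: _ => // a b ka kb; rewrite leq_min ka kb.
Qed.

(* Main.v *)
Require Import Defs.
From mathcomp Require Import all_boot all_order all_algebra.
From mathcomp Require Import all_classical all_reals all_analysis.
From mathcomp Require Import ring lra.
Import Order.TTheory GRing.Theory Num.Theory.
Import numFieldNormedType.Exports.
(* [dim] is the dimension of a stage, not that of a vector space. *)
Import Defs.
Local Open Scope classical_set_scope.
Local Open Scope ring_scope.
Set Implicit Arguments.
Unset Strict Implicit.
Unset Printing Implicit Defensive.

(** Only finitely many masses change with the samples, and each of them
    converges, because the indicator of a point of the finite support is a test
    function for weak convergence. Everything else is a Lipschitz estimate in
    these masses, with constants that depend on the program but not on the
    distributions.

    Optimal value. By compactness of the feasible set and relatively complete
    recourse, the stage costs of all reachable decisions have a common bound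
    ([reachable_cost_bounded]): every reachable decision occurs in some feasible
    solution of the whole tree, obtained by following a policy that passes
    through it ([reachable_on_policy]). Hence the recourse functions are bounded
    uniformly in the decision and in the distributions, and backward induction
    over the stages shows that replacing [P] by [Q] changes them, and then the
    optimal value, by at most a constant times the [l^1] gap between [P] and
    [Q] ([recourse_lipschitz], [opt_value_lipschitz]). The value is thus squeezed
    between [opt_value T M P] plus and minus a null sequence.

    Optimal solutions. The expected cost of a tree solution is a continuous
    function on a compact set, and it converges uniformly there
    ([expected_cost_lipschitz]). Outside an open neighbourhood of the set of
    true minimizers the true cost stays away from its minimum by compactness
    ([near_minimizers_in_open]), so a minimizer of a uniformly close cost lies in
    that neighbourhood. *)

(** * Policies and reachable decisions *)

(** A decision rule that depends on the previous decision and on the latest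
    observation only. It suffices for the extension of a path of decisions to
    the whole tree, because a path visits each stage once. *)
Definition policy (R : realType) (K : nat) (M : msp R K) : Type :=
  forall t, 'cV[R]_(dim M t) -> 'I_K -> 'cV[R]_(dim M t.+1).

Fixpoint follow (R : realType) (K : nat) (M : msp R K) (pol : policy M)
    (x0 : 'cV[R]_(dim M 0)) (h : seq 'I_K) : 'cV[R]_(dim M (size h)) :=
  match h with
  | [::] => x0
  | r :: h' => pol (size h') (follow pol x0 h') r
  end.

Definition admissible (R : realType) (K T : nat) (M : msp R K)
    (pol : policy M) : Prop :=
  forall t (y : 'cV[R]_(dim M t)) r,
    (t.+1 < T)%N -> reachable y -> next_stage r y (pol t y r).

Lemma exists_admissible (R : realType) (K T : nat) (M : msp R K) :
  relatively_complete_recourse T M -> exists pol : policy M, admissible T pol.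
Proof.
move=> rc; exists (fun t y r => xget 0 (next_stage r y)) => t y r tT hy.
by have [z hz] := rc t y r tT hy; exact: (xgetI 0 hz).
Qed.

Lemma reachable_follow (R : realType) (K T : nat) (M : msp R K)
    (pol : policy M) (x0 : 'cV[R]_(dim M 0)) (h : seq 'I_K) :
  admissible T pol -> first_stage M x0 -> (size h < T)%N ->
  reachable (follow pol x0 h).
Proof.
move=> adm fx0; elim: h => [|r h ih] //= hT.
have rh := ih (ltnW hT).
by exists (follow pol x0 h), r; split => //; exact: adm.
Qed.

Lemma feasible_follow (R : realType) (K T : nat) (M : msp R K)
    (pol : policy M) (x0 : 'cV[R]_(dim M 0)) :
  admissible T pol -> first_stage M x0 ->
  feasible T M (fun h => follow pol x0 h).
Proof.
move=> adm fx0; split => // h r hr.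
have hT : ((size h).+1 < T)%N by move: hr => /=; case: (T).
exact: (adm _ _ _ hT (reachable_follow adm fx0 (ltnW hT))).
Qed.

Lemma follow_eq (R : realType) (K : nat) (M : msp R K) (pol pol' : policy M)
    (x0 : 'cV[R]_(dim M 0)) (h : seq 'I_K) :
  (forall s, (s < size h)%N -> pol s = pol' s) ->
  follow pol x0 h = follow pol' x0 h.
Proof.
elim: h => [|r h ih] //= e; rewrite e ?ltnSn// ih// => s sh.
by apply: e; exact: ltnW.
Qed.

(** The rule is changed at stage [t] only, so that decisions up to stage [t] made
    by the policy are not affected. *)
Lemma admissible_through (R : realType) (K T : nat) (M : msp R K)
    (pol : policy M) t (y : 'cV[R]_(dim M t)) r z :
  admissible T pol -> (t.+1 < T)%N -> next_stage r y z ->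
  exists pol' : policy M, [/\ admissible T pol', pol' t y r = z &
    forall s, (s < t)%N -> pol' s = pol s].
Proof.
move=> adm tT hz; exists (dfwith pol t
  (fun y' r' => if (y' == y) && (r' == r) then z else pol t y' r')); split.
- move=> s y' r' sT hy'.
  have [est|nts] := eqVneq t s; last by rewrite dfwithout//; exact: adm.
  subst s; rewrite dfwithin; case: ifP => [/andP[/eqP -> /eqP ->]//|_].
  exact: adm.
- by rewrite dfwithin !eqxx.
- by move=> s st; rewrite dfwithout// gtn_eqF.
Qed.

(** Induction along a history of decisions that ends in [y], bending the policy
    at each step so that it takes the next decision of the history. Quantifying
    over predicates [Q] states that the decision at [h] is [y] without
    transporting [y] along the equation [size h = t]. *)
Lemma reachable_on_policy (R : realType) (K T : nat) (M : msp R K) t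
    (y : 'cV[R]_(dim M t)) :
  relatively_complete_recourse T M -> (t < T)%N -> reachable y ->
  exists (pol : policy M) x0 h,
    [/\ admissible T pol, first_stage M x0, size h = t &
     forall Q : (forall s, 'cV[R]_(dim M s) -> Prop),
       Q (size h) (follow pol x0 h) -> Q t y].
Proof.
move=> rc; elim: t y => [|t ih] y tT hy /=.
  have [pol adm] := exists_admissible rc.
  by exists pol, y, [::].
move: hy => [z [r [hz hy]]].
have [pol [x0 [h [adm fx0 ht eqz]]]] := ih z (ltnW tT) hz.
have [pol' [adm' poly eqpol]] := admissible_through adm tT hy.
exists pol', x0, (r :: h); split => //; first by rewrite /= ht.
move=> Q /=; rewrite (@follow_eq _ _ _ pol' pol); last first.
  by move=> s; rewrite ht; exact: eqpol.
by move=> /(eqz (fun s v => Q s.+1 (pol' s v r))); rewrite poly.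
Qed.

(** * Continuity on the space of tree solutions *)

Lemma continuous_mull (R : realType) (X : topologicalType) (a : R) (f : X -> R) :
  continuous f -> continuous (fun x => a * f x).
Proof. by move=> cf x; apply: cvgMr; exact: cf. Qed.

Lemma continuous_abs (R : realType) (X : topologicalType) (f : X -> R) :
  continuous f -> continuous (fun x => `|f x|).
Proof. by move=> cf x; apply: cvg_norm; exact: cf. Qed.

Lemma continuous_sqr_sub (R : realType) (X : topologicalType) (f : X -> R) (a : R) :
  continuous f -> continuous (fun x => (f x - a) ^+ 2).
Proof.
move=> cf x; have cd : f z - a @[z --> x] --> f x - a.
  by apply: cvgB; [exact: cf|exact: cvg_cst].
exact: (@cvgM _ _ _ _ _ _ _ _ cd cd).
Qed.

Lemma continuous_sqrt (R : realType) (X : topologicalType) (f : X -> R) :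
  continuous f -> continuous (fun x => Num.sqrt (f x)).
Proof. by move=> cf x; exact: (continuous_comp (cf x) (@sqrt_continuous R _)). Qed.

Lemma continuous_coordinate (R : realType) (K T : nat) (M : msp R K)
    (h : node K T) (j : 'I_(dim M (size h))) :
  continuous (fun x : solution T M => x h j 0).
Proof.
move=> x.
pose p : solution T M -> 'cV[R]_(dim M (size h)) := fun x => x h.
have cp : {for x, continuous p}.
  exact: (@proj_continuous _ (fun h : node K T => 'cV[R]_(dim M (size h)))).
exact: (continuous_comp cp (@coord_continuous _ _ _ j 0 _)).
Qed.

Lemma continuous_dotp (R : realType) (K T : nat) (M : msp R K) (h : node K T)
    (c : 'rV[R]_(dim M (size h))) :
  continuous (fun x : solution T M => dotp c (x h)).
Proof.
have -> : (fun x : solution T M => dotp c (x h)) =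
    (fun x : solution T M => \sum_j c 0 j * x h j 0).
  by apply: funext => x; rewrite /dotp mxE.
apply: continuous_big => [|j _]; first exact: add_continuous.
apply: continuous_mull; exact: continuous_coordinate.
Qed.

Lemma continuous_scenario_cost (R : realType) (K T : nat) (M : msp R K)
    (s : T.-1.-tuple 'I_K) :
  continuous (fun x : solution T M => scenario_cost x s).
Proof.
apply: continuous_big => [|k _]; first exact: add_continuous.
exact: continuous_dotp.
Qed.

Lemma continuous_expected_cost (R : realType) (K T : nat) (M : msp R K)
    (P : nat -> distr R K) :
  continuous (fun x : solution T M => expected_cost P x).
Proof.
apply: continuous_big => [|s _]; first exact: add_continuous.
apply: continuous_mull; exact: continuous_scenario_cost.
Qed.

Lemma continuous_sol_dist (R : realType) (K T : nat) (M : msp R K)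
    (y : solution T M) :
  continuous (fun x : solution T M => sol_dist x y).
Proof.
apply: continuous_sqrt.
apply: continuous_big => [|h _]; first exact: add_continuous.
apply: continuous_big => [|j _]; first exact: add_continuous.
apply: continuous_sqr_sub; exact: continuous_coordinate.
Qed.

Lemma compact_continuous_bounded (R : realType) (X : topologicalType)
    (A : set X) (f : X -> R) :
  compact A -> continuous f ->
  exists2 C : R, 0 <= C & forall x, A x -> `|f x| <= C.
Proof.
move=> cA cf; have [->|/set0P A0] := eqVneq A set0; first by exists 0.
have cnf : continuous (fun x => `|f x|) by exact: continuous_abs.
have [c _ hc] := compact_EVT_max A0 cA (continuous_subspaceT cnf).
by exists `|f c| => // x Ax; apply: hc; rewrite inE.
Qed.

(** * A common bound for the stage costs *)

Definition reachable_cost_le (R : realType) (K T : nat) (M : msp R K)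
    (C : R) : Prop :=
  forall t (y : 'cV[R]_(dim M t)) r z,
    (t.+1 < T)%N -> reachable y -> next_stage r y z ->
    `|dotp (cost M t r) z| <= C.

(** The sum of all absolute node costs is continuous on the compact feasible set,
    hence bounded, and each reachable decision [z] is a node decision of a
    feasible solution: a policy that reaches [y] is bent to take [z] after [y]. *)
Lemma reachable_cost_bounded (R : realType) (K T : nat) (M : msp R K) :
  compact (feasible T M) -> relatively_complete_recourse T M ->
  exists2 C : R, 0 <= C & reachable_cost_le T M C.
Proof.
move=> cF rc.
have [C C0 hC] : exists2 C : R, 0 <= C &
    forall x, feasible T M x ->
      `|\sum_(h : node K T) `|dotp (node_cost M h) (x h)| | <= C.
  apply: compact_continuous_bounded => //.
  apply: continuous_big => [|h _]; first exact: add_continuous.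
  apply: continuous_abs; exact: continuous_dotp.
exists C => // t y r z tT hy hz.
have [pol [x0 [h [adm fx0 ht eqy]]]] := reachable_on_policy rc (ltnW tT) hy.
have [pol' [adm' polz eqpol]] := admissible_through adm tT hz.
have hr : (size (r :: h) <= T.-1)%N by rewrite /= ht; case: (T) tT.
have := hC _ (feasible_follow adm' fx0).
rewrite (bigD1 (Bseq hr))//= ger0_norm; last by rewrite addr_ge0// sumr_ge0.
move=> hle.
have {}hle : `|dotp (cost M (size h) r) (pol' (size h) (follow pol' x0 h) r)| <= C.
  by apply: le_trans hle; rewrite lerDl sumr_ge0.
rewrite (@follow_eq _ _ _ pol' pol) in hle; last by move=> s; rewrite ht; exact: eqpol.
rewrite -polz.
exact: (eqy (fun s v => `|dotp (cost M s r) (pol' s v r)| <= C)).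
Qed.

(** * Dependence of the optimal value on the distributions *)

(** Stated in the extended reals because the infimum over an empty set of first
    stage decisions is [+oo]. *)
Lemma ereal_inf_shift (R : realType) (X : Type) (A : set X) (F G : X -> \bar R)
    (e : R) :
  (forall x, A x -> (F x <= G x + e%:E)%E) ->
  (ereal_inf [set F x | x in A] <= ereal_inf [set G x | x in A] + e%:E)%E.
Proof.
move=> FG; rewrite -leeBlDr//; apply: le_ereal_inf_tmp => _ [x Ax <-].
rewrite leeBlDr//; apply: le_trans (FG x Ax).
by apply: ereal_inf_lbound; exists x.
Qed.

Lemma bounded_real (R : realType) (I : Type) (v : I -> \bar R) (B : R) :
  (forall r, ((- B)%:E <= v r <= B%:E)%E) ->
  exists2 w : I -> R, v = (fun r => (w r)%:E) & forall r, `|w r| <= B.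
Proof.
move=> hv.
have fv r : v r = (fine (v r))%:E.
  move: (hv r); case: (v r) => [w| |] //=.
  by rewrite leye_eq andbF.
exists (fun r => fine (v r)); first exact: funext.
by move=> r; have := hv r; rewrite {1 2}fv !lee_fin ler_norml.
Qed.

Lemma expect_bounded (R : realType) (K : nat) (p : distr R K)
    (v : 'I_K -> \bar R) (B : R) :
  (forall r, ((- B)%:E <= v r <= B%:E)%E) ->
  ((- B)%:E <= \sum_r (p r)%:E * v r <= B%:E)%E.
Proof.
move=> /bounded_real[w -> hw].
under eq_bigr do rewrite -EFinM.
rewrite sumEFin !lee_fin -ler_norml.
apply: le_trans (ler_norm_sum _ _ _) _.
rewrite -[leRHS]mul1r -(mass_sum1 p) mulr_suml; apply: ler_sum => r _.
by rewrite normrM (ger0_norm (mass_ge0 p r)) ler_wpM2l// mass_ge0.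
Qed.

(** The two sources of error of one backward induction step: [D] is inherited
    from the later stages, and the change of distribution costs at most the bound
    [B] times the [l^1] distance. *)
Lemma expect_lipschitz (R : realType) (K : nat) (p q : distr R K)
    (u v : 'I_K -> \bar R) (B D : R) :
  (forall r, ((- B)%:E <= v r <= B%:E)%E) ->
  (forall r, (u r <= v r + D%:E)%E) ->
  (\sum_r (q r)%:E * u r <=
     \sum_r (p r)%:E * v r + (D + B * \sum_r `|q r - p r|)%:E)%E.
Proof.
move=> /bounded_real[w -> hw] huw.
apply: (@le_trans _ _ (\sum_r (q r * (w r + D))%:E)%E).
  apply: lee_sum => r _; rewrite EFinM EFinD; apply: lee_wpmul2l => //.
  by rewrite lee_fin mass_ge0.
under [X in (_ <= X + _)%E]eq_bigr do rewrite -EFinM.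
rewrite !sumEFin -EFinD lee_fin -[X in X + B * _]mul1r -(mass_sum1 q).
rewrite mulr_suml mulr_sumr -!big_split/=; apply: ler_sum => r _.
rewrite mulrDr addrA addrAC lerD2r.
have -> : q r * w r = p r * w r + (q r - p r) * w r by ring.
rewrite lerD2l; apply: le_trans (ler_norm _) _.
by rewrite normrM mulrC ler_wpM2r.
Qed.

(** The bound does not depend on [P], which is what makes the estimate below
    uniform along the reference distributions. Relatively complete recourse gives
    the upper bound, since it keeps the infimum from being over an empty set. *)
Lemma recourse_uniformly_bounded (R : realType) (K T : nat) (M : msp R K)
    (C : R) (P : nat -> distr R K) k t (y : 'cV[R]_(dim M t)) r :
  relatively_complete_recourse T M ->
  reachable_cost_le T M C ->
  (t.+1 + k < T)%N -> reachable y ->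
  ((- (C *+ k.+1))%:E <= recourse P k y r <= (C *+ k.+1)%:E)%E.
Proof.
move=> rc hC; elim: k t y r => [|k ih] t y r tk hy.
- have [z hz] := rc _ _ r (leq_ltn_trans (leq_addr _ _) tk) hy.
  have tT := leq_ltn_trans (leq_addr _ _) tk.
  apply/andP; split.
    apply: le_ereal_inf_tmp => _ [x hx <-]; rewrite adde0 lee_fin.
    by have := hC _ _ _ _ tT hy hx; rewrite ler_norml => /andP[].
  apply: le_trans (ereal_inf_lbound _) _; first by exists z; [exact: hz|].
  rewrite adde0 lee_fin.
  by have := hC _ _ _ _ tT hy hz; rewrite ler_norml => /andP[].
have tT := leq_ltn_trans (leq_addr _ _) tk.
have [z hz] := rc _ _ r tT hy.
have bnd x : next_stage r y x -> ((- (C *+ k.+1))%:E <=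
    \sum_(r' : 'I_K) (P t.+1 r')%:E * recourse P k x r' <= (C *+ k.+1)%:E)%E.
  move=> hx; apply: expect_bounded => r'; apply: ih.
    by rewrite addSnnS.
  by exists y, r.
apply/andP; split.
  apply: le_ereal_inf_tmp => _ [x hx <-].
  rewrite mulrS opprD EFinD; apply: leeD; last by case/andP: (bnd x hx).
  by have := hC _ _ _ _ tT hy hx; rewrite lee_fin ler_norml => /andP[].
apply: le_trans (ereal_inf_lbound _) _; first by exists z; [exact: hz|].
rewrite mulrS EFinD; apply: leeD; last by case/andP: (bnd z hz).
by have := hC _ _ _ _ tT hy hz; rewrite lee_fin ler_norml => /andP[].
Qed.

Definition distr_gap (R : realType) (K T : nat) (P Q : nat -> distr R K) : R :=
  \sum_(t < T.-1) \sum_r `|Q t r - P t r|.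

Lemma stage_gap_le (R : realType) (K T : nat) (P Q : nat -> distr R K) t :
  (t.+1 < T)%N -> \sum_r `|Q t r - P t r| <= distr_gap T P Q.
Proof.
move=> tT; have tT' : (t < T.-1)%N by case: (T) tT.
rewrite /distr_gap (bigD1 (Ordinal tT'))//= lerDl.
by apply: sumr_ge0 => i _; apply: sumr_ge0.
Qed.

(** The step to [k.+1] adds the error [C *+ k.+1 * distr_gap T P Q], the price of
    a change of distribution for recourse functions bounded by [C *+ k.+1], and
    [k.+1 <= T]. Exchanging [P] and [Q] turns the one-sided estimate into a
    bound for the absolute difference. *)
Lemma recourse_lipschitz (R : realType) (K T : nat) (M : msp R K)
    (C : R) (P Q : nat -> distr R K) k t (y : 'cV[R]_(dim M t)) r :
  0 <= C -> relatively_complete_recourse T M ->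
  reachable_cost_le T M C ->
  (t.+1 + k < T)%N -> reachable y ->
  (recourse Q k y r <= recourse P k y r + ((C *+ T * distr_gap T P Q) *+ k)%:E)%E.
Proof.
move=> C0 rc hC; elim: k t y r => [|k ih] t y r tk hy; first by rewrite adde0.
have tT := leq_ltn_trans (leq_addr _ _) tk.
have tk' : (t.+2 + k < T)%N by rewrite addSnnS.
apply: ereal_inf_shift => x hx.
have hrx : reachable (t := t.+1) x by exists y, r.
rewrite -addeA; apply: leeD => //.
apply: le_trans (expect_lipschitz (P t.+1) _
  (fun r' => recourse_uniformly_bounded P r' rc hC tk' hrx)
  (fun r' => ih _ x r' tk' hrx)) _.
apply: leeD => //; rewrite lee_fin [leRHS]mulrSr lerD2l.
apply: ler_pM => //; first by rewrite mulrn_wge0.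
- exact: sumr_ge0.
- by apply: ler_wpMn2l => //; apply: ltnW; apply: leq_ltn_trans tk; exact: leq_addl.
- apply: stage_gap_le; apply: leq_ltn_trans tk.
  by rewrite addnS ltnS leq_addr.
Qed.

Lemma opt_value_lipschitz (R : realType) (K T : nat) (M : msp R K) (C : R)
    (P Q : nat -> distr R K) :
  (2 <= T)%N -> 0 <= C -> relatively_complete_recourse T M ->
  reachable_cost_le T M C ->
  (opt_value T M Q <=
     opt_value T M P + ((C *+ T * distr_gap T P Q) *+ T.-1)%:E)%E.
Proof.
move=> hT C0 rc hC.
have tk : (1 + (T - 2) < T)%N by rewrite -[X in (_ < X)%N](subnKC hT).
apply: ereal_inf_shift => x hx.
rewrite -addeA; apply: leeD => //.
apply: le_trans (expect_lipschitz (P 0%N) _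
  (fun r' => recourse_uniformly_bounded P r' rc hC tk hx)
  (fun r' => recourse_lipschitz P Q r' C0 rc hC tk hx)) _.
apply: leeD => //; rewrite lee_fin.
have -> : T.-1 = (T - 2).+1 by case: (T) hT => [|[|n]]//; rewrite !subSS subn0.
rewrite [leRHS]mulrSr lerD2l.
apply: ler_pM => //; first by rewrite mulrn_wge0.
- exact: sumr_ge0.
- by apply: ler_wpMn2l => //; rewrite (leq_trans _ tk)// -addn1 addnC.
- exact: stage_gap_le.
Qed.

(** * Convergence of the probabilities as the sample sizes grow *)

Lemma bigmin_nat_le (I : eqType) (s : seq I) (a : nat) (F : I -> nat) j :
  j \in s -> (\big[minn/a]_(i <- s) F i <= F j)%N.
Proof.
elim: s => // i s ih; rewrite inE big_cons geq_min => /orP[/eqP ->|/ih ->].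
  by rewrite leqnn.
by rewrite orbT.
Qed.

Lemma sample_size_cvg (T t : nat) :
  (t.+1 < T)%N -> N t @[N --> min_size_oo T] --> \oo.
Proof.
move=> tT; have tT' : (t < T.-1)%N by case: (T) tT.
apply/cvgnyPge => n; exists n => // N /= /leq_trans; apply.
exact: (bigmin_nat_le _ _ (mem_index_enum (Ordinal tT'))).
Qed.

Lemma expect_indicator (R : realType) (K : nat) (p : distr R K) r :
  expect p (fun r' => (r' == r)%:R) = p r.
Proof.
rewrite /expect (bigD1 r)//= eqxx mulr1 big1 ?addr0// => i /negPf ->.
by rewrite mulr0.
Qed.

Lemma cvg_sumr (R : realType) (X I : Type) (s : seq I) (F : set_system X)
    (f : I -> X -> R) (l : I -> R) : Filter F ->
  (forall i, f i x @[x --> F] --> l i) ->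
  \sum_(i <- s) f i x @[x --> F] --> \sum_(i <- s) l i.
Proof. by move=> FF fl; apply: cvg_big => //; exact: add_continuous. Qed.

Lemma mass_cvg (R : realType) (K T : nat) (P : nat -> distr R K)
    (f0 : nat -> nat -> distr R K) t r :
  (forall t : nat, (t.+1 < T)%N -> weak_cvg (f0 t) (P t)) ->
  (t.+1 < T)%N ->
  f0 t (N t) r @[N --> min_size_oo T] --> P t r.
Proof.
move=> hf0 tT; have := hf0 t tT (fun r' => (r' == r)%:R).
rewrite expect_indicator; under eq_fun do rewrite expect_indicator.
by move=> hc; exact: (cvg_comp _ _ (sample_size_cvg tT) hc).
Qed.

Lemma distr_gap_cvg (R : realType) (K T : nat) (P : nat -> distr R K)
    (f0 : nat -> nat -> distr R K) :
  (forall t : nat, (t.+1 < T)%N -> weak_cvg (f0 t) (P t)) ->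
  distr_gap T P (fun t => f0 t (N t)) @[N --> min_size_oo T] --> (0 : R).
Proof.
move=> hf0.
have -> : (0 : R) = \sum_(t < T.-1) \sum_(r < K) 0 by rewrite big1// => i; rewrite big1.
apply: cvg_sumr => t; apply: cvg_sumr => r.
rewrite -[X in _ --> X](normr0 R); apply: cvg_norm; apply/subr_cvg0.
by apply: mass_cvg => //; case: t => t /=; case: (T).
Qed.

Lemma distr_gapC (R : realType) (K T : nat) (P Q : nat -> distr R K) :
  distr_gap T P Q = distr_gap T Q P.
Proof. by apply: eq_bigr => t _; apply: eq_bigr => r _; exact: distrC. Qed.

Lemma history_prob_cvg (R : realType) (K T : nat) (P : nat -> distr R K)
    (f0 : nat -> nat -> distr R K) (h : seq 'I_K) :
  (forall t : nat, (t.+1 < T)%N -> weak_cvg (f0 t) (P t)) ->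
  (size h <= T.-1)%N ->
  history_prob (fun t => f0 t (N t)) h @[N --> min_size_oo T]
    --> history_prob P h.
Proof.
move=> hf0; elim: h => [|r h ih] /= hT; first exact: cvg_cst.
apply: cvgM; last exact: ih (ltnW hT).
by apply: mass_cvg => //; case: (T) hT.
Qed.

Definition history_gap (R : realType) (K T : nat) (P Q : nat -> distr R K) : R :=
  \sum_(s : T.-1.-tuple 'I_K) `|history_prob Q s - history_prob P s|.

Lemma history_gap_cvg (R : realType) (K T : nat) (P : nat -> distr R K)
    (f0 : nat -> nat -> distr R K) :
  (forall t : nat, (t.+1 < T)%N -> weak_cvg (f0 t) (P t)) ->
  history_gap T P (fun t => f0 t (N t)) @[N --> min_size_oo T] --> (0 : R).
Proof.
move=> hf0.
have -> : (0 : R) = \sum_(s : T.-1.-tuple 'I_K) 0 by rewrite big1.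
apply: cvg_sumr => s.
rewrite -[X in _ --> X](normr0 R); apply: cvg_norm; apply/subr_cvg0.
by apply: history_prob_cvg => //; rewrite size_tuple.
Qed.

(** * Stability of the set of minimizers *)

Lemma expected_cost_lipschitz (R : realType) (K T : nat) (M : msp R K) :
  compact (feasible T M) ->
  exists2 C : R, 0 <= C & forall (P Q : nat -> distr R K) x, feasible T M x ->
    `|expected_cost Q x - expected_cost P x| <= C * history_gap T P Q.
Proof.
move=> cF.
have [C C0 hC] : exists2 C : R, 0 <= C & forall x, feasible T M x ->
    `|\sum_(s : T.-1.-tuple 'I_K) `|scenario_cost x s| | <= C.
  apply: compact_continuous_bounded => //.
  apply: continuous_big => [|s _]; first exact: add_continuous.
  by apply: continuous_abs; exact: continuous_scenario_cost.
exists C => // P Q x hx; rewrite /expected_cost -sumrB mulr_sumr.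
apply: le_trans (ler_norm_sum _ _ _) _; apply: ler_sum => s _.
rewrite -mulrBl normrM mulrC ler_wpM2r//; apply: le_trans (hC x hx).
rewrite (bigD1 s)//= [leRHS]ger0_norm; last by rewrite addr_ge0// sumr_ge0.
by rewrite lerDl sumr_ge0.
Qed.

(** On the compact set of points of [A] outside [O] the function attains its
    minimum at a point that is not a minimizer on [A], so it stays above the
    value at some better point; half of that difference serves as [d]. *)
Lemma near_minimizers_in_open (R : realType) (X : topologicalType)
    (A O : set X) (f : X -> R) :
  compact A -> continuous f -> open O ->
  (forall x, A x -> (forall y, A y -> f x <= f y) -> O x) ->
  exists2 d : R, 0 < d &
    forall x, A x -> (forall y, A y -> f x <= f y + d) -> O x.
Proof.
move=> cA cf oO hO.
have cB : compact (A `&` ~` O) by apply: compact_closedI => //; exact: open_closedC.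
have [B0|/set0P B0] := eqVneq (A `&` ~` O) set0.
  exists 1 => // x Ax _; apply: contrapT => nOx.
  by have : (A `&` ~` O) x by []; rewrite B0.
have [c] := compact_EVT_min B0 cB (continuous_subspaceT cf).
rewrite inE => -[Ac nOc] hc.
have [y Ay fyc] : exists2 y, A y & f y < f c.
  apply: contrapT => hn; apply: nOc; apply: hO => // y Ay.
  by rewrite leNgt; apply/negP => fyc; apply: hn; exists y.
exists ((f c - f y) / 2); first by rewrite divr_gt0// subr_gt0.
move=> x Ax hx; apply: contrapT => nOx.
have fcx : f c <= f x by apply: hc; rewrite inE.
have := hx y Ay; lra.
Qed.

Lemma sol_dist_self (R : realType) (K T : nat) (M : msp R K)
    (x : solution T M) : sol_dist x x = 0.
Proof.
rewrite /sol_dist big1 ?sqrtr0// => h _; rewrite big1// => j _.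
by rewrite subrr expr0n.
Qed.

Lemma dist_to_set_ge0 (R : realType) (K T : nat) (M : msp R K)
    (x : solution T M) (U : set (solution T M)) : 0 <= dist_to_set x U.
Proof.
rewrite /dist_to_set; have [->|/set0P[u Uu]] := eqVneq U set0.
  by rewrite image_set0 inf0.
apply: lb_le_inf; first by exists (sol_dist x u), u.
by move=> _ [v _ <-]; exact: sqrtr_ge0.
Qed.

Lemma dist_to_set_le (R : realType) (K T : nat) (M : msp R K)
    (x u : solution T M) (U : set (solution T M)) :
  U u -> dist_to_set x U <= sol_dist x u.
Proof.
move=> Uu; apply: ge_inf; last by exists u.
by exists 0 => _ [v _ <-]; exact: sqrtr_ge0.
Qed.

Lemma deviation_le (R : realType) (K T : nat) (M : msp R K)
    (V U : set (solution T M)) (e : R) :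
  0 <= e -> (forall x, V x -> exists2 u, U u & sol_dist x u <= e) ->
  `|deviation V U| <= e.
Proof.
move=> e0 hV; rewrite /deviation.
have [->|/set0P[v Vv]] := eqVneq V set0; first by rewrite image_set0 sup0 normr0.
have ub : ubound [set dist_to_set x U | x in V] e.
  move=> _ [x Vx <-]; have [u Uu xu] := hV x Vx.
  exact: le_trans (dist_to_set_le _ Uu) xu.
rewrite ger0_norm; first by apply: ge_sup => //; exists (dist_to_set v U), v.
apply: le_trans (dist_to_set_ge0 v U) _.
by apply: ub_le_sup; [exists e|exists v].
Qed.

(** * Convergence of optimal values and optimal solutions *)

Theorem proposition1 (R : realType) (K T : nat) (hT : (2 <= T)%N)
    (M : msp R K) (P : nat -> distr R K) (f0 : nat -> nat -> distr R K)
    (hf0 : forall t : nat, (t.+1 < T)%N -> weak_cvg (f0 t) (P t))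
    (hcompact : compact (feasible T M))
    (hrecourse : relatively_complete_recourse T M)
    (hbounded : bounded_recourse T M P) :
  (opt_value T M (fun t => f0 t (N t)) @[N --> min_size_oo T]
     --> opt_value T M P) /\
  (deviation (opt_solutions T M (fun t => f0 t (N t)))
             (opt_solutions T M P) @[N --> min_size_oo T] --> (0 : R)).
Proof.
split.
- have [C C0 hC] := reachable_cost_bounded hcompact hrecourse.
  pose e N : R := (C *+ T * distr_gap T P (fun t => f0 t (N t))) *+ T.-1.
  have e0 : e N @[N --> min_size_oo T] --> (0 : R).
    have -> : e = fun N =>
        C *+ T *+ T.-1 * distr_gap T P (fun t => f0 t (N t)).
      by apply: funext => N; rewrite /e [RHS]mulrnAl.
    rewrite -[X in _ --> X](mulr0 (C *+ T *+ T.-1)).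
    apply: cvgMr; exact: distr_gap_cvg.
  have eE : (e N)%:E @[N --> min_size_oo T] --> (0 : \bar R).
    by apply/fine_cvgP; split; first exact: nearW.
  apply: (squeeze_cvge (f := fun N => (opt_value T M P - (e N)%:E)%E)
    (h := fun N => (opt_value T M P + (e N)%:E)%E)).
  + apply: nearW => N; rewrite leeBlDr//; apply/andP; split.
      rewrite /e distr_gapC; exact: opt_value_lipschitz.
    exact: opt_value_lipschitz.
  + rewrite -[X in _ --> X]adde0 -oppe0.
    apply: cvgeD; [by rewrite oppe0 fin_num_adde_defl|exact: cvg_cst|exact: cvgeN].
  + rewrite -[X in _ --> X]adde0.
    by apply: cvgeD; [rewrite fin_num_adde_defl|exact: cvg_cst|].
- have [C C0 hC] := expected_cost_lipschitz hcompact.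
  apply/cvgr0Pnorm_le => eps eps0.
  pose O : set (solution T M) := \bigcup_(u in opt_solutions T M P)
    [set x : solution T M | sol_dist x u < eps].
  have oO : open O.
    apply: bigcup_open => u _.
    apply: (@open_comp _ _ (fun x : solution T M => sol_dist x u) [set z | z < eps]).
      by move=> x _; exact: continuous_sol_dist.
    exact: open_lt.
  have hO x : feasible T M x ->
      (forall y, feasible T M y -> expected_cost P x <= expected_cost P y) -> O x.
    by move=> fx hx; exists x => //=; rewrite sol_dist_self.
  have [d d0 hd] := near_minimizers_in_open hcompact
    (@continuous_expected_cost R K T M P) oO hO.
  have gap0 : C * history_gap T P (fun t => f0 t (N t))
      @[N --> min_size_oo T] --> (0 : R).
    rewrite -[X in _ --> X](mulr0 C); apply: cvgMr; exact: history_gap_cvg.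
  (* The costs are compared twice, at the reference solution and at its
     competitor, so each comparison may cost [d / 2]. *)
  have /cvgr0Pnorm_le /(_ (d / 2)) := gap0.
  rewrite divr_gt0// => /(_ isT); apply: filterS => N hN.
  apply: deviation_le; first exact: ltW.
  move=> x [fx hx].
  have [u Uu xu] : O x; last by exists u => //; exact: ltW.
  apply: hd => // y fy; have := hx y fy.
  have := le_trans (hC P (fun t => f0 t (N t)) x fx) (le_trans (ler_norm _) hN).
  have := le_trans (hC P (fun t => f0 t (N t)) y fy) (le_trans (ler_norm _) hN).
  rewrite !ler_norml => /andP[_ h1] /andP[h2 _] h3; lra.
Qed.
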